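(* Let $T>0$ and $\lambda<1/4$. There is a positive constant $c$, depending only on $\lambda$ and $T$ (in particular independent of $h$), such that for every mesh size $h=1/(N+1)$ with $N$ an even positive integer and for all initial data $\mathbf{u}^h(0)\in\mathrm{Span}\{\boldsymbol{\varphi}^h_n:\ |n|\le\lambda N\}$, the solution $\mathbf{u}^h$ of the conservative semidiscrete scheme $$i\frac{d u^h_j}{dt}+\frac{u^h_{j+1}-2u^h_j+u^h_{j-1}}{h^2}=0,\quad t>0,\ j=0,\dots,N,$$ with the periodicity conventions $u^h_{-1}=u^h_N$ and $u^h_{N+1}=u^h_0$, and with initial datum $\mathbf{u}^h(0)$, satisfies $$\|\mathbf{u}^h\|_{L^4(0,T;L^4(\mathbb{T}_h))}\le c\,\|\mathbf{u}^h(0)\|_{L^2(\mathbb{T}_h)}.$$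
   Context: $N$ denotes an even positive integer and $h=1/(N+1)$ is the mesh size. For an integer $n$ with $-N/2\le n\le N/2$, $\boldsymbol{\varphi}^h_n=(\varphi^h_{nj})_{j=0}^N$ is the vector with entries $\varphi^h_{nj}=\exp(2i\pi n j h)$; spans are over $\mathbb{C}$. For $1\le p<\infty$, $L^p(\mathbb{T}_h)$ is the space of complex vectors $\mathbf{u}=(u_0,\dots,u_N)$ endowed with the norm $\|\mathbf{u}\|_{L^p(\mathbb{T}_h)}^p=h\sum_{j=0}^N|u_j|^p$. For a time-dependent vector $\mathbf{u}^h(t)=(u^h_j(t))_{j=0}^N$, $\|\mathbf{u}^h\|_{L^4(0,T;L^4(\mathbb{T}_h))}=\big(\int_0^T\|\mathbf{u}^h(t)\|_{L^4(\mathbb{T}_h)}^4\,dt\big)^{1/4}$. *)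

(* Defs.v *)
From Stdlib Require Import Reals ZArith.
From Coquelicot Require Import Coquelicot.
Open Scope R_scope.

(* Exponents here are arbitrary reals; [Rpower] alone cannot be used for norms
   because [Rpower 0 p = 1]. *)
Definition rpow (x p : R) : R :=
  if Req_dec_T x 0 then 0 else Rpower x p.

Definition Cexp (z : C) : C :=
  Cmult (RtoC (exp (Re z))) (cos (Im z), sin (Im z)).

Definition mesh (N : nat) : R := 1 / INR (N + 1).

(* A vector (u_0, ..., u_N) is a function [nat -> C] of which only the values
   at 0, ..., N are ever used; equalities of vectors are stated for j <= N. *)
Definition vec : Type := nat -> C.

Definition phi (N : nat) (n : Z) : vec := fun j =>
  Cexp (Cmult Ci (RtoC (2 * PI * IZR n * INR j * mesh N))).

(* Span over C of the phi_n with -N/2 <= n <= N/2 and |n| <= lam * N.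
   N is even, so the N + 1 frequencies are k - N/2 with 0 <= k <= N. *)
Definition in_low_freq_span (N : nat) (lam : R) (u : vec) : Prop :=
  exists a : Z -> C,
    (forall n : Z, ~ (Rabs (IZR n) <= lam * INR N) -> a n = RtoC 0) /\
    (forall j : nat, (j <= N)%nat ->
       u j = sum_n (fun k : nat =>
               let n := (Z.of_nat k - Z.of_nat (Nat.div N 2))%Z in
               Cmult (a n) (phi N n j)) N).

Definition Lp_norm (N : nat) (p : R) (u : vec) : R :=
  rpow (mesh N * sum_n (fun j : nat => rpow (Cmod (u j)) p) N) (/ p).

(* [RInt] is the Riemann integral; it is only applied to u continuous in time
   on [0, T]. *)
Definition LqLp_norm (N : nat) (q p T : R) (u : R -> vec) : R :=
  rpow (RInt (fun t : R => rpow (Lp_norm N p (u t)) q) 0 T) (/ q).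

(* u_{j+1} and u_{j-1} for 0 <= j <= N, with u_{N+1} = u_0 and u_{-1} = u_N. *)
Definition next (N : nat) (u : vec) (j : nat) : C :=
  if Nat.eqb j N then u 0%nat else u (S j).
Definition prev (N : nat) (u : vec) (j : nat) : C :=
  match j with O => u N | S i => u i end.

Definition discrete_laplacian (N : nat) (u : vec) (j : nat) : C :=
  Cdiv (Cplus (Cminus (next N u j) (Cmult (RtoC 2) (u j))) (prev N u j))
       (RtoC (mesh N ^ 2)).

(* The equation holds for t > 0 and the initial datum is attained continuously
   from the right; values at t < 0 are irrelevant. *)
Definition is_solution (N : nat) (u0 : vec) (u : R -> vec) : Prop :=
  forall j : nat, (j <= N)%nat ->
    u 0 j = u0 j /\
    filterlim (fun t : R => u t j) (at_right 0) (locally (u0 j)) /\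
    (forall t : R, 0 < t ->
       exists d : C,
         @is_derive R_AbsRing C_R_NormedModule (fun s : R => u s j) t d /\
         Cplus (Cmult Ci d) (discrete_laplacian N (u t) j) = RtoC 0).

(* Main.v *)
Require Import Defs.
From Stdlib Require Import Reals ZArith Lra Lia.
From Coquelicot Require Import Coquelicot.
Open Scope R_scope.

(** The solution is the trigonometric sum
      u_j(t) = sum_n a_n exp(-i omega_n t) exp(2 i pi n j h),
    with omega_n = (2 - 2 cos(2 pi n h)) / h^2 ([laplacian_trig]); conservation of the
    discrete L^2 norm shows that the scheme has no other solution with this datum
    ([solves_zero], [is_solution_unique]).

    By orthogonality of the characters on the grid, the fourth moment h sum_j |u_j(t)|^4
    is the sum of
      a_n a_m conj(a_p) conj(a_q) exp(-i (omega_n + omega_m - omega_p - omega_q) t)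
    over the quadruples with n + m = p + q ([trig_fourth_moment]).  There is no aliasing:
    |n + m - p - q| <= 4 lam N < N + 1, so a congruence modulo N + 1 is an equality.

    The decisive point is the phase.  When n + m = p + q,
      omega_n + omega_m - omega_p - omega_q
        = (8 / h^2) cos(pi h (n + m)) sin(pi h (n - p)) sin(pi h (n - q)),
    and the arguments of the cosine and of both sines lie in [-2 pi lam, 2 pi lam], an
    interval on which the cosine is at least kappa = cos(2 pi lam), and kappa > 0 because
    lam < 1/4.  Hence the phase is at least 2 kappa^3 |p - n| |q - n| in absolute
    value, uniformly in h ([omega_gap]), as for the Schrodinger equation on the torus,
    where the corresponding phase is proportional to (p - n) (q - n).

    Integrating in time, each term is bounded by its modulus times T if p = n or q = n,
    and times 2 / |phase| otherwise; in all cases by a constant C(T, lam) times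
    w(p - n) + w(q - n), where w(x) = 1 / (1 + x^2) ([resonant_time_integral]).  As w is
    summable over the integers and three of the four frequencies determine the last,
    Schur's test bounds the sum over quadruples by 12 C (sum_n |a_n|^2)^2
    ([resonant_sum_le]).  By Parseval ([trig_second_moment]) the last factor is the fourth
    power of the discrete L^2 norm of the datum. *)

(** * Finite sums *)

(* The lemmas on [sum_n] state equalities in the carrier of an abelian monoid; [ring] needs
   to see the concrete type. *)
Ltac to_R := match goal with |- @eq _ ?x ?y => change (@eq R x y) end.
Ltac to_C := match goal with |- @eq _ ?x ?y => change (@eq C x y) end.

Lemma sum_n_mult_l_C (a : C) (f : nat -> C) n :
  (a * sum_n f n)%C = sum_n (fun k => (a * f k)%C) n.
Proof. symmetry; exact (sum_n_mult_l (K := C_Ring) a f n). Qed.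

Lemma sum_n_mult_r_C (a : C) (f : nat -> C) n :
  (sum_n f n * a)%C = sum_n (fun k => (f k * a)%C) n.
Proof. symmetry; exact (sum_n_mult_r (K := C_Ring) a f n). Qed.

Lemma sum_n_mult_l_R (a : R) (f : nat -> R) n :
  a * sum_n f n = sum_n (fun k => a * f k) n.
Proof. symmetry; exact (sum_n_mult_l (K := R_Ring) a f n). Qed.

Lemma sum_n_mult_r_R (a : R) (f : nat -> R) n :
  sum_n f n * a = sum_n (fun k => f k * a) n.
Proof. symmetry; exact (sum_n_mult_r (K := R_Ring) a f n). Qed.

Lemma sum_n_plus_R (f g : nat -> R) n :
  sum_n (fun k => f k + g k) n = sum_n f n + sum_n g n.
Proof. exact (sum_n_plus f g n). Qed.

Lemma Cconj_sum_n (f : nat -> C) n :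
  Cconj (sum_n f n) = sum_n (fun k => Cconj (f k)) n.
Proof.
  induction n as [|n IH]; [now rewrite !sum_O|].
  rewrite !sum_Sn, <- IH; apply Cplus_conj.
Qed.

Lemma Re_sum_n (f : nat -> C) n : Re (sum_n f n) = sum_n (fun k => Re (f k)) n.
Proof.
  induction n as [|n IH]; [now rewrite !sum_O|].
  now rewrite !sum_Sn, <- IH.
Qed.

Lemma Im_sum_n (f : nat -> C) n : Im (sum_n f n) = sum_n (fun k => Im (f k)) n.
Proof.
  induction n as [|n IH]; [now rewrite !sum_O|].
  now rewrite !sum_Sn, <- IH.
Qed.

Lemma sum_n_le_R (f g : nat -> R) n :
  (forall k, (k <= n)%nat -> f k <= g k) -> sum_n f n <= sum_n g n.
Proof.
  induction n as [|n IH]; intros H; [rewrite !sum_O; apply H; lia|].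
  rewrite !sum_Sn; apply Rplus_le_compat; [apply IH; intros; apply H; lia|apply H; lia].
Qed.

Lemma sum_n_0_R n : sum_n (fun _ : nat => 0) n = 0.
Proof. rewrite sum_n_const; exact (Rmult_0_r _). Qed.

Lemma sum_n_ge_0 (f : nat -> R) n :
  (forall k, (k <= n)%nat -> 0 <= f k) -> 0 <= sum_n f n.
Proof.
  intros H; rewrite <- (sum_n_0_R n); now apply sum_n_le_R.
Qed.

Lemma sum_n_one_index (f : nat -> R) (x : R) (i n : nat) :
  (forall k, (k <= n)%nat -> k <> i -> f k = 0) -> f i = x -> 0 <= x ->
  sum_n f n <= x.
Proof.
  intros H Hi Hx.
  enough (sum_n f n = if le_dec i n then x else 0) as -> by (destruct le_dec; lra).
  induction n as [|n IH].
  - rewrite sum_O; destruct le_dec as [l|l].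
    + now replace 0%nat with i by lia.
    + apply H; lia.
  - rewrite sum_Sn, IH by (intros; apply H; lia).
    destruct (le_dec i n), (le_dec i (S n)); try lia.
    + rewrite (H (S n)) by lia. apply Rplus_0_r.
    + replace (S n) with i by lia. rewrite Hi. apply Rplus_0_l.
    + rewrite (H (S n)) by lia. apply Rplus_0_r.
Qed.

Lemma is_RInt_sum_n (f : nat -> R -> R) (v : nat -> R) (a b : R) n :
  (forall k, (k <= n)%nat -> is_RInt (f k) a b (v k)) ->
  is_RInt (fun t => sum_n (fun k => f k t) n) a b (sum_n v n).
Proof.
  induction n as [|n IH]; intros H.
  - rewrite sum_O.
    apply is_RInt_ext with (f 0%nat); [intros; now rewrite sum_O|apply H; lia].
  - rewrite sum_Sn.
    apply is_RInt_ext with (fun t => plus (sum_n (fun k => f k t) n) (f (S n) t)).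
    { intros; now rewrite sum_Sn. }
    apply (is_RInt_plus (V := R_NormedModule) (fun t => sum_n (fun k => f k t) n)
      (f (S n)) a b (sum_n v n) (v (S n))); [apply IH; intros; apply H; lia|apply H; lia].
Qed.

Definition sum4 {G : AbelianMonoid} (N : nat) (f : nat -> nat -> nat -> nat -> G) : G :=
  sum_n (fun a => sum_n (fun b => sum_n (fun c => sum_n (fun d =>
    f a b c d) N) N) N) N.

Lemma sum4_ext {G : AbelianMonoid} N (f g : nat -> nat -> nat -> nat -> G) :
  (forall a b c d, (a <= N)%nat -> (b <= N)%nat -> (c <= N)%nat -> (d <= N)%nat ->
    f a b c d = g a b c d) -> sum4 N f = sum4 N g.
Proof.
  intros H; unfold sum4.
  apply sum_n_ext_loc; intros a Ha; apply sum_n_ext_loc; intros b Hb.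
  apply sum_n_ext_loc; intros c Hc; apply sum_n_ext_loc; intros d Hd; auto.
Qed.

Lemma sum4_le N (f g : nat -> nat -> nat -> nat -> R) :
  (forall a b c d, (a <= N)%nat -> (b <= N)%nat -> (c <= N)%nat -> (d <= N)%nat ->
    f a b c d <= g a b c d) -> sum4 N f <= sum4 N g.
Proof.
  intros H; unfold sum4.
  apply sum_n_le_R; intros a Ha; apply sum_n_le_R; intros b Hb.
  apply sum_n_le_R; intros c Hc; apply sum_n_le_R; intros d Hd; auto.
Qed.

Lemma sum_n_sum4 {G : AbelianMonoid} N M (f : nat -> nat -> nat -> nat -> nat -> G) :
  sum_n (fun j => sum4 N (f j)) M =
  sum4 N (fun a b c d => sum_n (fun j => f j a b c d) M).
Proof.
  unfold sum4.
  rewrite sum_n_switch; apply sum_n_ext; intros a.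
  rewrite sum_n_switch; apply sum_n_ext; intros b.
  rewrite sum_n_switch; apply sum_n_ext; intros c.
  now rewrite sum_n_switch.
Qed.

Lemma sum_n_prod4 N (f g p q : nat -> C) :
  (sum_n f N * sum_n g N * sum_n p N * sum_n q N)%C =
  sum4 N (fun a b c d => f a * g b * p c * q d)%C.
Proof.
  unfold sum4.
  rewrite !sum_n_mult_r_C; apply sum_n_ext; intros a.
  rewrite (sum_n_mult_l_C (f a)), !sum_n_mult_r_C; apply sum_n_ext; intros b.
  rewrite (sum_n_mult_l_C (f a * g b)), !sum_n_mult_r_C; apply sum_n_ext; intros c.
  now rewrite sum_n_mult_l_C.
Qed.

Lemma Re_sum4 N (f : nat -> nat -> nat -> nat -> C) :
  Re (sum4 N f) = sum4 N (fun a b c d => Re (f a b c d)).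
Proof.
  unfold sum4.
  rewrite Re_sum_n; apply sum_n_ext; intros a.
  rewrite Re_sum_n; apply sum_n_ext; intros b.
  rewrite Re_sum_n; apply sum_n_ext; intros c.
  now rewrite Re_sum_n.
Qed.

Lemma sum4_mult_l_R N x (f : nat -> nat -> nat -> nat -> R) :
  x * sum4 N f = sum4 N (fun a b c d => x * f a b c d).
Proof.
  unfold sum4.
  rewrite sum_n_mult_l_R; apply sum_n_ext; intros a.
  rewrite sum_n_mult_l_R; apply sum_n_ext; intros b.
  rewrite sum_n_mult_l_R; apply sum_n_ext; intros c.
  now rewrite sum_n_mult_l_R.
Qed.

Lemma sum4_plus_R N (f g : nat -> nat -> nat -> nat -> R) :
  sum4 N (fun a b c d => f a b c d + g a b c d) = sum4 N f + sum4 N g.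
Proof.
  unfold sum4.
  rewrite <- sum_n_plus_R; apply sum_n_ext; intros a.
  rewrite <- sum_n_plus_R; apply sum_n_ext; intros b.
  rewrite <- sum_n_plus_R; apply sum_n_ext; intros c.
  now rewrite <- sum_n_plus_R.
Qed.

Lemma is_RInt_sum4 N (f : nat -> nat -> nat -> nat -> R -> R) v (x y : R) :
  (forall a b c d, is_RInt (f a b c d) x y (v a b c d)) ->
  is_RInt (fun t => sum4 N (fun a b c d => f a b c d t)) x y (sum4 N v).
Proof.
  intros H; unfold sum4.
  apply (is_RInt_sum_n (fun a t => sum_n (fun b => sum_n (fun c => sum_n (fun d =>
    f a b c d t) N) N) N)); intros a _.
  apply (is_RInt_sum_n (fun b t => sum_n (fun c => sum_n (fun d =>
    f a b c d t) N) N)); intros b _.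
  apply (is_RInt_sum_n (fun c t => sum_n (fun d => f a b c d t) N)); intros c _.
  apply is_RInt_sum_n; intros d _; apply H.
Qed.

(** With the two transpositions below, this gives the symmetries of the resonance condition
    a + b = c + d. *)
Lemma sum4_swap_pairs {G : AbelianMonoid} N (f : nat -> nat -> nat -> nat -> G) :
  sum4 N f = sum4 N (fun c d a b => f a b c d).
Proof.
  unfold sum4.
  transitivity (sum_n (fun a => sum_n (fun c => sum_n (fun d => sum_n (fun b => f a b c d) N) N) N) N).
  { apply sum_n_ext; intros a. rewrite sum_n_switch.
    apply sum_n_ext; intros c. apply sum_n_switch. }
  rewrite sum_n_switch. apply sum_n_ext; intros c. apply sum_n_switch.
Qed.

Lemma sum4_swap_last {G : AbelianMonoid} N (f : nat -> nat -> nat -> nat -> G) :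
  sum4 N f = sum4 N (fun a b d c => f a b c d).
Proof.
  unfold sum4.
  apply sum_n_ext; intros a. apply sum_n_ext; intros b. apply sum_n_switch.
Qed.

Lemma sum4_swap_first {G : AbelianMonoid} N (f : nat -> nat -> nat -> nat -> G) :
  sum4 N f = sum4 N (fun b a c d => f a b c d).
Proof. unfold sum4; apply sum_n_switch. Qed.

(** * Sums over resonant quadruples *)

(** The decay of the time integrals in the distance between frequencies: comparable to
    1 / x^2 at nonzero integers, and equal to 1 at 0, where there is no oscillation. *)
Definition wt (x : R) : R := / (1 + x ^ 2).

Lemma wt_pos x : 0 < wt x.
Proof. unfold wt; apply Rinv_0_lt_compat; nra. Qed.

Lemma wt_even x : wt (- x) = wt x.
Proof. unfold wt; f_equal; ring. Qed.

(** The bounded increasing function d / (1 + |d|) has increments of order 1 / d^2, so that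
    sums of [wt] over consecutive integers telescope. *)
Lemma wt_telescope (d : Z) :
  wt (IZR d) <= 3 * (IZR (d + 1) / (1 + Rabs (IZR (d + 1))) - IZR d / (1 + Rabs (IZR d))).
Proof.
  unfold wt; rewrite plus_IZR.
  assert (Hq : 0 < 1 + IZR d ^ 2) by nra.
  destruct (Z_le_gt_dec 0 d) as [H|H].
  - assert (Hd : 0 <= IZR d) by now apply IZR_le.
    (* The inequality (d + 1) (d + 2) <= 3 (1 + d^2) fails for real d between 1/2 and 1. *)
    assert (Hi : 0 <= (2 * IZR d - 1) * (IZR d - 1)).
    { rewrite <- mult_IZR, <- !minus_IZR, <- mult_IZR. apply IZR_le.
      destruct (Z.eq_dec d 0); [subst; lia|nia]. }
    rewrite !Rabs_pos_eq by lra.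
    replace (3 * ((IZR d + 1) / (1 + (IZR d + 1)) - IZR d / (1 + IZR d)))
      with (/ ((IZR d + 1) * (IZR d + 2) / 3)) by (field; lra).
    apply Rinv_le_contravar; nra.
  - assert (Hd : IZR d <= -1) by (apply IZR_le; lia).
    rewrite !Rabs_left1 by lra.
    replace (3 * ((IZR d + 1) / (1 + - (IZR d + 1)) - IZR d / (1 + - IZR d)))
      with (/ (- IZR d * (1 - IZR d) / 3)) by (field; lra).
    apply Rinv_le_contravar; nra.
Qed.

Lemma sum_wt_le (m : nat) (n : nat) :
  sum_n (fun k => wt (INR k - INR m)) n <= 6.
Proof.
  set (g := fun d : Z => IZR d / (1 + Rabs (IZR d))).
  assert (Hg : forall d, Rabs (g d) <= 1).
  { intros d; unfold g, Rdiv. pose proof (Rabs_pos (IZR d)).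
    rewrite Rabs_mult, (Rabs_pos_eq (/ _)) by (left; apply Rinv_0_lt_compat; lra).
    apply Rmult_le_reg_r with (1 + Rabs (IZR d)); [lra|].
    rewrite Rmult_assoc, Rinv_l; lra. }
  enough (H : sum_n (fun k => wt (INR k - INR m)) n <=
    3 * (g (Z.of_nat (S n) - Z.of_nat m)%Z - g (0 - Z.of_nat m)%Z)).
  { pose proof (Hg (Z.of_nat (S n) - Z.of_nat m)%Z).
    pose proof (Hg (0 - Z.of_nat m)%Z).
    apply Rabs_le_between in H0, H1. lra. }
  assert (Hs : forall k : nat, wt (INR k - INR m) <=
    3 * (g (Z.of_nat (S k) - Z.of_nat m)%Z - g (Z.of_nat k - Z.of_nat m)%Z)).
  { intros k. rewrite !INR_IZR_INZ, <- minus_IZR.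
    replace (Z.of_nat (S k) - Z.of_nat m)%Z with (Z.of_nat k - Z.of_nat m + 1)%Z by lia.
    apply wt_telescope. }
  induction n as [|n IH].
  - rewrite sum_O; apply (Hs 0%nat).
  - rewrite sum_Sn; change plus with Rplus; cbv beta.
    specialize (Hs (S n)). lra.
Qed.

(** For fixed a and b, the index c determines d, so the inner double sum is at most
    (A a * A b)^2 times the sum of the weights. *)
Lemma resonant_sum_squares (A : nat -> R) N :
  sum4 N (fun a b c d => if Nat.eqb (a + b) (c + d)
     then (A a) ^ 2 * (A b) ^ 2 * wt (INR c - INR a) else 0)
  <= 6 * (sum_n (fun k => (A k) ^ 2) N) ^ 2.
Proof.
  unfold sum4.
  apply Rle_trans with
    (sum_n (fun a => sum_n (fun b => A a ^ 2 * A b ^ 2 * 6) N) N).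
  - apply sum_n_le_R; intros a _; apply sum_n_le_R; intros b _.
    assert (Hab : 0 <= A a ^ 2 * A b ^ 2) by (apply Rmult_le_pos; apply pow2_ge_0).
    apply Rle_trans with (sum_n (fun c => A a ^ 2 * A b ^ 2 * wt (INR c - INR a)) N).
    + apply sum_n_le_R; intros c _.
      pose proof (wt_pos (INR c - INR a)).
      destruct (le_dec c (a + b)) as [Hc|Hc].
      * apply sum_n_one_index with (a + b - c)%nat; [| |nra].
        -- intros k _ Hk; destruct (Nat.eqb_spec (a + b) (c + k)); [lia|easy].
        -- destruct (Nat.eqb_spec (a + b) (c + (a + b - c))); [easy|lia].
      * rewrite sum_n_ext_loc with (b := fun _ => 0).
        { rewrite sum_n_0_R; nra. }
        intros k _; destruct (Nat.eqb_spec (a + b) (c + k)); [lia|easy].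
    + rewrite <- sum_n_mult_l_R. apply Rmult_le_compat_l; [easy|apply sum_wt_le].
  - right. rewrite <- Rsqr_pow2; unfold Rsqr.
    rewrite sum_n_mult_r_R, sum_n_mult_l_R; apply sum_n_ext; intros a.
    rewrite !sum_n_mult_l_R; apply sum_n_ext; intros b. to_R; ring.
Qed.

(** Schur's test: A a * A b * A c * A d is at most half of (A a * A b)^2 + (A c * A d)^2, and
    the symmetries of the resonance condition reduce the four resulting sums to the
    preceding one. *)
Lemma resonant_sum_le (A : nat -> R) N :
  sum4 N (fun a b c d => if Nat.eqb (a + b) (c + d)
     then A a * A b * A c * A d * (wt (INR c - INR a) + wt (INR d - INR a)) else 0)
  <= 12 * (sum_n (fun k => (A k) ^ 2) N) ^ 2.
Proof.
  set (F := fun a b c d : nat => if Nat.eqb (a + b) (c + d)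
     then (A a) ^ 2 * (A b) ^ 2 * wt (INR c - INR a) else 0).
  assert (HF : sum4 N F <= 6 * (sum_n (fun k => A k ^ 2) N) ^ 2) by apply resonant_sum_squares.
  apply Rle_trans with (sum4 N (fun a b c d =>
     / 2 * ((F a b c d + F c d a b) + (F a b d c + F d c a b)))).
  - apply sum4_le; intros a b c d _ _ _ _; unfold F.
    rewrite (Nat.eqb_sym (c + d)), (Nat.add_comm d c), (Nat.eqb_sym (c + d)).
    destruct (Nat.eqb _ _); [|lra].
    replace (INR a - INR c) with (- (INR c - INR a)) by ring.
    replace (INR a - INR d) with (- (INR d - INR a)) by ring.
    rewrite !wt_even.
    pose proof (wt_pos (INR c - INR a)); pose proof (wt_pos (INR d - INR a)).
    assert (2 * (A a * A b * A c * A d) <= A a ^ 2 * A b ^ 2 + A c ^ 2 * A d ^ 2).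
    { pose proof (pow2_ge_0 (A a * A b - A c * A d)). nra. }
    nra.
  - rewrite <- sum4_mult_l_R, !sum4_plus_R.
    rewrite <- (sum4_swap_pairs N F).
    rewrite <- (sum4_swap_last N F).
    replace (sum4 N (fun a b c d => F d c a b)) with (sum4 N F).
    { change (sum4 N (fun a b c d => F a b c d)) with (sum4 N F). lra. }
    rewrite (sum4_swap_first N F), (sum4_swap_pairs N). easy.
Qed.

(** * Characters and moments on the periodic grid *)

Definition cis (x : R) : C := (cos x, sin x).

Lemma cis_plus x y : cis (x + y) = (cis x * cis y)%C.
Proof.
  unfold cis, Cmult; simpl; rewrite cos_plus, sin_plus; f_equal; ring.
Qed.

Lemma cis_0 : cis 0 = RtoC 1.
Proof. unfold cis; now rewrite cos_0, sin_0. Qed.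

Lemma cis_conj x : Cconj (cis x) = cis (- x).
Proof. unfold cis, Cconj; simpl; now rewrite cos_neg, sin_neg. Qed.

Lemma cis_period_nat x n : cis (x + 2 * INR n * PI) = cis x.
Proof. unfold cis; now rewrite cos_period, sin_period. Qed.

Lemma cis_2PI (q : Z) : cis (2 * PI * IZR q) = RtoC 1.
Proof.
  destruct (Z_le_gt_dec 0 q) as [H|H].
  - rewrite <- (Z2Nat.id q), <- INR_IZR_INZ by easy.
    rewrite <- cis_0, <- (cis_period_nat 0 (Z.to_nat q)); f_equal; ring.
  - rewrite <- (cis_period_nat _ (Z.to_nat (- q))).
    rewrite INR_IZR_INZ, Z2Nat.id, opp_IZR by lia.
    rewrite <- cis_0; f_equal; ring.
Qed.

Lemma Cmod_cis x : Cmod (cis x) = 1.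
Proof.
  unfold cis, Cmod; simpl.
  replace (_ + _) with 1; [apply sqrt_1|].
  pose proof (sin2_cos2 x); unfold Rsqr in *; lra.
Qed.

Lemma cis_neq_1 x : x <> 0 -> Rabs x < 2 * PI -> cis x <> RtoC 1.
Proof.
  intros Hx Hb H. apply (f_equal fst) in H; simpl in H.
  assert (Hs : sin (x / 2) = 0).
  { replace x with (2 * (x / 2)) in H by field.
    rewrite cos_2a_sin in H. nra. }
  apply Rabs_def2 in Hb.
  destruct (Rtotal_order x 0) as [Hx0|[Hx0|Hx0]]; [|easy|].
  - pose proof (sin_gt_0 (- (x / 2))). rewrite sin_neg in H0. lra.
  - pose proof (sin_gt_0 (x / 2)). lra.
Qed.

Lemma sum_n_cis_geometric x n :
  ((1 - cis x) * sum_n (fun j => cis (x * INR j)) n = 1 - cis (x * INR (S n)))%C.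
Proof.
  induction n as [|n IH].
  - rewrite sum_O. simpl. rewrite Rmult_0_r, Rmult_1_r, cis_0. ring.
  - rewrite sum_Sn. change plus with Cplus; cbv beta.
    rewrite Cmult_plus_distr_l, IH.
    rewrite (S_INR (S n)), Rmult_plus_distr_l, Rmult_1_r, cis_plus. ring.
Qed.

Lemma mesh_pos N : 0 < mesh N.
Proof.
  unfold mesh, Rdiv; rewrite Rmult_1_l; apply Rinv_0_lt_compat, lt_0_INR; lia.
Qed.

Lemma mesh_mult N : mesh N * INR (S N) = 1.
Proof.
  unfold mesh; rewrite Nat.add_1_r; field; apply not_0_INR; lia.
Qed.

(** For q <> 0 the condition |q| < N + 1 makes the ratio exp(2 i pi q h) of the geometric sum
    different from 1, while its power N + 1 is 1. *)
Lemma sum_n_cis_orthogonal N (q : Z) :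
  Rabs (IZR q) < INR (S N) ->
  sum_n (fun j => cis (2 * PI * IZR q * mesh N * INR j)) N =
  if Z.eqb q 0 then RtoC (INR (S N)) else RtoC 0.
Proof.
  intros Hq. destruct (Z.eqb_spec q 0) as [->|Hq0].
  - rewrite (sum_n_ext _ (fun _ => RtoC 1)).
    + clear; induction N as [|N IH].
      * now rewrite sum_O.
      * rewrite sum_Sn, IH, (S_INR (S N)), RtoC_plus; easy.
    + intros j. rewrite <- cis_0; f_equal; ring.
  - set (x := 2 * PI * IZR q * mesh N).
    pose proof (mesh_pos N); pose proof (mesh_mult N); pose proof PI_RGT_0.
    assert (Hx : cis x <> RtoC 1).
    { apply cis_neq_1; unfold x.
      - apply eq_IZR_contrapositive in Hq0.
        intros E. apply Rmult_integral in E as [E|E]; [|lra].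
        apply Rmult_integral in E as [E|E]; [lra|easy].
      - rewrite !Rabs_mult, (Rabs_pos_eq 2), (Rabs_pos_eq PI), (Rabs_pos_eq (mesh N)) by lra.
        assert (Rabs (IZR q) * mesh N < 1).
        { rewrite <- H0, Rmult_comm. now apply Rmult_lt_compat_l. }
        rewrite Rmult_assoc. nra. }
    pose proof (sum_n_cis_geometric x N) as Hg.
    replace (x * INR (S N)) with (2 * PI * IZR q) in Hg
      by (transitivity (2 * PI * IZR q * (mesh N * INR (S N))); [rewrite H0|unfold x]; ring).
    rewrite cis_2PI in Hg.
    replace (RtoC 1 - RtoC 1)%C with (RtoC 0) in Hg by ring.
    destruct (Ceq_dec (sum_n (fun j => cis (x * INR j)) N) 0) as [->|Hn]; [easy|].
    exfalso. apply Cmult_neq_0 in Hg; trivial.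
    intros E. apply Hx. symmetry. replace (RtoC 1) with ((1 - cis x) + cis x)%C by ring.
    rewrite E; ring.
Qed.

(** The frequencies -N/2, ..., N/2 are indexed by k = 0, ..., N.  The shift by N/2 cancels in
    a resonance condition with two indices on each side. *)
Definition freq (N k : nat) : Z := (Z.of_nat k - Z.of_nat (Nat.div N 2))%Z.

Definition angle (N k : nat) : R := 2 * PI * IZR (freq N k) * mesh N.

Lemma phi_cis N k j : phi N (freq N k) j = cis (angle N k * INR j).
Proof.
  unfold phi, Cexp.
  replace (Ci * _)%C with (0, angle N k * INR j).
  - unfold cis; simpl. rewrite exp_0. apply Cmult_1_l.
  - unfold angle, Ci, Cmult, RtoC; simpl; f_equal; ring.
Qed.

Definition trig (N : nat) (b : nat -> C) (j : nat) : C :=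
  sum_n (fun k => b k * cis (angle N k * INR j))%C N.

Lemma Cmod_pow4 z : Cmod z ^ 4 = Re (z * z * Cconj z * Cconj z)%C.
Proof.
  replace (z * z * Cconj z * Cconj z)%C with ((z * Cconj z) * (z * Cconj z))%C by ring.
  rewrite <- Cmod2_conj, <- RtoC_mult. simpl. ring.
Qed.

Lemma IZR_freq N k : IZR (freq N k) = INR k - INR (Nat.div N 2).
Proof. unfold freq; now rewrite minus_IZR, <- !INR_IZR_INZ. Qed.

Lemma mean_cis N (q : Z) (z : C) :
  Rabs (IZR q) < INR (S N) ->
  mesh N * sum_n (fun j => Re (z * cis (2 * PI * IZR q * mesh N * INR j))) N
   = if Z.eqb q 0 then Re z else 0.
Proof.
  intros Hq.
  rewrite <- Re_sum_n, <- sum_n_mult_l_C, sum_n_cis_orthogonal by easy.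
  assert (E : forall r : R, Re (z * r)%C = Re z * r) by (intros r; unfold Re; simpl; ring).
  destruct (Z.eqb q 0); rewrite E; [|ring].
  rewrite (Rmult_comm (Re z)), <- Rmult_assoc, mesh_mult. apply Rmult_1_l.
Qed.

Definition low_freq (N : nat) (lam : R) (a : nat -> C) : Prop :=
  forall k, (k <= N)%nat -> a k = RtoC 0 \/ Rabs (IZR (freq N k)) <= lam * INR N.

(** Lets every estimate on a quadruple assume that its four frequencies are low. *)
Lemma low_freq_product N lam a k1 k2 k3 k4 : low_freq N lam a ->
  (k1 <= N)%nat -> (k2 <= N)%nat -> (k3 <= N)%nat -> (k4 <= N)%nat ->
  (a k1 * a k2 * Cconj (a k3) * Cconj (a k4))%C = RtoC 0 \/
  (Rabs (IZR (freq N k1)) <= lam * INR N /\ Rabs (IZR (freq N k2)) <= lam * INR N /\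
   Rabs (IZR (freq N k3)) <= lam * INR N /\ Rabs (IZR (freq N k4)) <= lam * INR N).
Proof.
  intros Ha H1 H2 H3 H4.
  assert (E0 : Cconj (RtoC 0) = RtoC 0) by (unfold Cconj, RtoC; simpl; now rewrite Ropp_0).
  destruct (Ha k1 H1) as [E|?]; [left; rewrite E; ring|].
  destruct (Ha k2 H2) as [E|?]; [left; rewrite E; ring|].
  destruct (Ha k3 H3) as [E|?]; [left; rewrite E, E0; ring|].
  destruct (Ha k4 H4) as [E|?]; [left; rewrite E, E0; ring|].
  right; auto.
Qed.

(** Expand |z|^4 = z z conj(z) conj(z) and average each product of four characters over the
    grid.  The frequency k1 + k2 - k3 - k4 is smaller than N + 1 in absolute value because
    lam < 1/4, so its average is 1 or 0 according to the resonance condition. *)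
Lemma trig_fourth_moment N lam (b : nat -> C) :
  (0 < N)%nat -> lam < 1 / 4 ->
  low_freq N lam b ->
  mesh N * sum_n (fun j => Cmod (trig N b j) ^ 4) N =
  sum4 N (fun k1 k2 k3 k4 => if Nat.eqb (k1 + k2) (k3 + k4)
    then Re (b k1 * b k2 * Cconj (b k3) * Cconj (b k4))%C else 0).
Proof.
  intros HN Hlam Hb.
  rewrite (sum_n_ext _ (fun j => sum4 N (fun k1 k2 k3 k4 =>
     Re ((b k1 * b k2 * Cconj (b k3) * Cconj (b k4)) *
        cis (2 * PI * IZR (freq N k1 + freq N k2 - freq N k3 - freq N k4) * mesh N * INR j))%C))).
  2:{ intros j. to_R. rewrite Cmod_pow4. unfold trig.
      rewrite Cconj_sum_n, sum_n_prod4, Re_sum4.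
      apply sum4_ext; intros k1 k2 k3 k4 _ _ _ _. to_R. f_equal.
      rewrite !minus_IZR, plus_IZR.
      replace (2 * PI * (IZR (freq N k1) + IZR (freq N k2) - IZR (freq N k3) - IZR (freq N k4)) * mesh N * INR j)
       with (angle N k1 * INR j + angle N k2 * INR j + (- (angle N k3 * INR j))
          + (- (angle N k4 * INR j))) by (unfold angle; ring).
      rewrite !cis_plus, !Cmult_conj, !cis_conj. ring. }
  rewrite sum_n_sum4, sum4_mult_l_R.
  apply sum4_ext; intros k1 k2 k3 k4 H1 H2 H3 H4. to_R.
  set (z := (b k1 * b k2 * Cconj (b k3) * Cconj (b k4))%C).
  destruct (low_freq_product N lam b k1 k2 k3 k4 Hb H1 H2 H3 H4) as [E|(F1 & F2 & F3 & F4)].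
  - fold z in E; rewrite E. rewrite (sum_n_ext _ (fun _ => 0)).
    + rewrite sum_n_0_R, Rmult_0_r. now destruct (Nat.eqb _ _).
    + intros j. to_R. simpl. ring.
  - rewrite mean_cis.
    + replace (Z.eqb _ 0) with (Nat.eqb (k1 + k2) (k3 + k4)); [easy|].
      unfold freq.
      destruct (Nat.eqb_spec (k1 + k2) (k3 + k4)), (Z.eqb_spec (Z.of_nat k1 - Z.of_nat (N / 2) + (Z.of_nat k2 - Z.of_nat (N / 2)) -
    (Z.of_nat k3 - Z.of_nat (N / 2)) - (Z.of_nat k4 - Z.of_nat (N / 2))) 0); lia.
    + rewrite !minus_IZR, plus_IZR, S_INR.
      apply lt_INR in HN; simpl in HN.
      apply Rabs_le_between in F1, F2, F3, F4.
      apply Rabs_def1; nra.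
Qed.

(** Parseval's identity: two of the N + 1 frequencies differ by at most N, so distinct ones
    are orthogonal on the grid. *)
Lemma trig_second_moment N (b : nat -> C) :
  mesh N * sum_n (fun j => Cmod (trig N b j) ^ 2) N =
  sum_n (fun k => Cmod (b k) ^ 2) N.
Proof.
  rewrite (sum_n_ext _ (fun j => sum_n (fun k => sum_n (fun l =>
     Re ((b k * Cconj (b l)) * cis (2 * PI * IZR (freq N k - freq N l) * mesh N * INR j))%C) N) N)).
  2:{ intros j. to_R.
      replace (Cmod (trig N b j) ^ 2) with (Re (trig N b j * Cconj (trig N b j))%C)
        by now rewrite <- Cmod2_conj.
      unfold trig. rewrite Cconj_sum_n, sum_n_mult_r_C, Re_sum_n.
      apply sum_n_ext; intros k. rewrite sum_n_mult_l_C, Re_sum_n.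
      apply sum_n_ext; intros l. to_R. f_equal.
      rewrite minus_IZR.
      replace (2 * PI * (IZR (freq N k) - IZR (freq N l)) * mesh N * INR j)
       with (angle N k * INR j + - (angle N l * INR j)) by (unfold angle; ring).
      rewrite cis_plus, Cmult_conj, cis_conj. ring. }
  rewrite sum_n_switch, sum_n_mult_l_R.
  apply sum_n_ext_loc; intros k Hk. rewrite sum_n_switch, sum_n_mult_l_R. to_R.
  rewrite (sum_n_ext_loc _ (fun l => if Nat.eqb l k then Cmod (b k) ^ 2 else 0)).
  - clear - Hk.
    enough (forall n, sum_n (fun l => if Nat.eqb l k then Cmod (b k) ^ 2 else 0) n =
       if le_dec k n then Cmod (b k) ^ 2 else 0) as ->.
    { destruct le_dec; [easy|lia]. }
    induction n as [|n IH].
    + rewrite sum_O. destruct (Nat.eqb_spec 0 k), (le_dec k 0); try lia; easy.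
    + rewrite sum_Sn, IH. change plus with Rplus.
      destruct (Nat.eqb_spec (S n) k), (le_dec k n), (le_dec k (S n)); try lia; to_R; ring.
  - intros l Hl. to_R. rewrite mean_cis.
    + unfold freq. destruct (Nat.eqb_spec l k) as [->|Hlk].
      * rewrite <- Cmod2_conj, Z.sub_diag. easy.
      * destruct (Z.eqb_spec (Z.of_nat k - Z.of_nat (N / 2) - (Z.of_nat l - Z.of_nat (N / 2))) 0); [lia|easy].
    + rewrite minus_IZR, !IZR_freq, S_INR. apply le_INR in Hk, Hl.
      pose proof (pos_INR k); pose proof (pos_INR l). apply Rabs_def1; lra.
Qed.

(** * Dispersion relation and time integrals *)

(** The eigenvalue of minus the discrete Laplacian, also equal to (4 / h^2) sin^2(pi n h). *)
Definition omega (N k : nat) : R := (2 - 2 * cos (angle N k)) / mesh N ^ 2.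

(** Two applications of the sum-to-product formulas: both pairs have the same half-sum, so
    the difference is a multiple of a difference of the cosines of the half-differences,
    which factors again. *)
Lemma cos_resonance a b c d : a + b = c + d ->
  cos a + cos b - cos c - cos d =
  - (4 * cos ((a + b) / 2) * sin ((a - c) / 2) * sin ((a - d) / 2)).
Proof.
  intros H.
  replace (cos a + cos b - cos c - cos d) with ((cos a + cos b) - (cos c + cos d)) by ring.
  rewrite (form1 a b), (form1 c d), <- H.
  replace (_ - _) with (2 * cos ((a + b) / 2) * (cos ((a - b) / 2) - cos ((c - d) / 2))) by ring.
  rewrite form2.
  replace (((a - b) / 2 - (c - d) / 2) / 2) with ((a - c) / 2) by lra.
  replace (((a - b) / 2 + (c - d) / 2) / 2) with ((a - d) / 2) by lra.
  ring.
Qed.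

Lemma cos_ge_of_abs_le M x : 0 <= M <= PI -> Rabs x <= M -> cos M <= cos x.
Proof.
  intros HM Hx.
  assert (cos x = cos (Rabs x)) as ->.
  { unfold Rabs; destruct Rcase_abs; [now rewrite cos_neg|easy]. }
  pose proof (Rabs_pos x).
  apply cos_decr_1; lra.
Qed.

(** The mean value theorem: sin x = x cos c for some c between 0 and x. *)
Lemma abs_sin_ge M x : 0 <= M <= PI -> Rabs x <= M -> cos M * Rabs x <= Rabs (sin x).
Proof.
  intros HM Hx.
  destruct (MVT_gen sin 0 x cos) as [c [Hc E]].
  - intros y _. auto_derive; [easy|ring].
  - intros y _. apply derivable_continuous_pt, derivable_pt_sin.
  - rewrite sin_0, !Rminus_0_r in E. rewrite E, Rabs_mult.
    apply Rmult_le_compat_r; [apply Rabs_pos|].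
    apply Rle_trans with (cos c); [|apply Rle_abs].
    apply cos_ge_of_abs_le; [easy|].
    apply Rle_trans with (Rabs x); [|easy].
    revert Hc; unfold Rmin, Rmax, Rabs; destruct Rle_dec, Rcase_abs, Rcase_abs; lra.
Qed.

(** The phase is a product of one cosine and two sines of angles at most 2 pi lam < pi / 2.
    The cosine is bounded below, each sine is at least a multiple of h times a difference of
    frequencies, and these two factors h compensate the 1 / h^2 of the Laplacian: the bound
    does not depend on N. *)
Lemma omega_gap N lam k1 k2 k3 k4 :
  0 <= lam < 1 / 4 -> (k1 + k2 = k3 + k4)%nat ->
  Rabs (IZR (freq N k1)) <= lam * INR N -> Rabs (IZR (freq N k2)) <= lam * INR N ->
  Rabs (IZR (freq N k3)) <= lam * INR N -> Rabs (IZR (freq N k4)) <= lam * INR N ->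
  2 * cos (2 * PI * lam) ^ 3 * (Rabs (INR k3 - INR k1) * Rabs (INR k4 - INR k1))
  <= Rabs (omega N k1 + omega N k2 - omega N k3 - omega N k4).
Proof.
  intros Hlam Hk F1 F2 F3 F4.
  pose proof (mesh_pos N) as Hh; pose proof (mesh_mult N) as Hm; pose proof PI_RGT_0 as HPI.
  assert (HM : 0 <= 2 * PI * lam <= PI) by nra.
  assert (HM2 : 0 < cos (2 * PI * lam)) by (apply cos_gt_0; nra).
  assert (Hk' : INR k1 + INR k2 = INR k3 + INR k4) by (rewrite <- !plus_INR; now f_equal).
  assert (Hang : angle N k1 + angle N k2 = angle N k3 + angle N k4).
  { unfold angle; rewrite !IZR_freq.
    transitivity (2 * PI * mesh N * (INR k1 + INR k2 - 2 * INR (N / 2))); [ring|].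
    rewrite Hk'; ring. }
  replace (omega N k1 + omega N k2 - omega N k3 - omega N k4) with (8 / mesh N ^ 2 * (cos ((angle N k1 + angle N k2) / 2) *
    sin ((angle N k1 - angle N k3) / 2) * sin ((angle N k1 - angle N k4) / 2))).
  2:{ pose proof (cos_resonance _ _ _ _ Hang) as E.
      transitivity (-2 / mesh N ^ 2 * (cos (angle N k1) + cos (angle N k2)
         - cos (angle N k3) - cos (angle N k4))); [rewrite E|unfold omega]; field; lra. }
  assert (HhN : mesh N * INR N <= 1).
  { rewrite S_INR in Hm. lra. }
  pose proof (pos_INR N) as HN0.
  assert (Hsmall : forall x, Rabs x <= 2 * (lam * INR N) -> Rabs (PI * mesh N * x) <= 2 * PI * lam).
  { intros x Hx. rewrite !Rabs_mult, (Rabs_pos_eq PI), (Rabs_pos_eq (mesh N)) by lra.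
    apply Rle_trans with (PI * mesh N * (2 * (lam * INR N))).
    - apply Rmult_le_compat_l; nra.
    - replace (PI * mesh N * (2 * (lam * INR N))) with (2 * PI * lam * (mesh N * INR N)) by ring.
      nra. }
  assert (Hc : cos (2 * PI * lam) <= cos ((angle N k1 + angle N k2) / 2)).
  { apply cos_ge_of_abs_le; [easy|].
    replace ((angle N k1 + angle N k2) / 2) with (PI * mesh N * (IZR (freq N k1) + IZR (freq N k2)))
      by (unfold angle; field).
    apply Hsmall. eapply Rle_trans; [apply Rabs_triang|]. lra. }
  assert (Hs : forall k, Rabs (IZR (freq N k)) <= lam * INR N ->
    cos (2 * PI * lam) * (PI * mesh N * Rabs (INR k - INR k1))
    <= Rabs (sin ((angle N k1 - angle N k) / 2))).
  { intros k F.
    assert (E : (angle N k1 - angle N k) / 2 = PI * mesh N * (IZR (freq N k1) - IZR (freq N k)))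
      by (unfold angle; field).
    replace (PI * mesh N * Rabs (INR k - INR k1)) with (Rabs ((angle N k1 - angle N k) / 2)).
    - apply abs_sin_ge; [easy|]. rewrite E. apply Hsmall.
      unfold Rminus; eapply Rle_trans; [apply Rabs_triang|]. rewrite Rabs_Ropp. lra.
    - rewrite E, !Rabs_mult, (Rabs_pos_eq PI), (Rabs_pos_eq (mesh N)) by lra.
      f_equal. rewrite !IZR_freq, <- Rabs_Ropp. f_equal; ring. }
  pose proof (Hs k3 F3) as H3; pose proof (Hs k4 F4) as H4.
  set (K := cos (2 * PI * lam)) in *.
  set (X := Rabs (INR k3 - INR k1)) in *; set (Y := Rabs (INR k4 - INR k1)) in *.
  assert (0 <= X) by apply Rabs_pos. assert (0 <= Y) by apply Rabs_pos.
  rewrite !Rabs_mult, (Rabs_pos_eq (8 / _)), (Rabs_pos_eq (cos _)).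
  2: lra.
  2:{ apply Rlt_le, Rdiv_lt_0_compat; [lra|now apply pow_lt]. }
  apply Rle_trans with (8 / mesh N ^ 2 * (K * (K * (PI * mesh N * X)) * (K * (PI * mesh N * Y)))).
  - replace (8 / mesh N ^ 2 * (K * (K * (PI * mesh N * X)) * (K * (PI * mesh N * Y))))
      with (8 * PI ^ 2 * (K ^ 3 * (X * Y))) by (field; lra).
    assert (0 <= K ^ 3 * (X * Y)).
    { apply Rmult_le_pos; [apply pow_le; lra|now apply Rmult_le_pos]. }
    pose proof PI2_3_2 as HPI3.
    assert (2 <= 8 * PI ^ 2) by nra.
    rewrite Rmult_assoc. now apply Rmult_le_compat_r.
  - assert (0 <= PI * mesh N * X) by (apply Rmult_le_pos; [apply Rmult_le_pos; lra|easy]).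
    assert (0 <= PI * mesh N * Y) by (apply Rmult_le_pos; [apply Rmult_le_pos; lra|easy]).
    apply Rmult_le_compat_l.
    { apply Rlt_le, Rdiv_lt_0_compat; [lra|now apply pow_lt]. }
    apply Rmult_le_compat; [|apply Rmult_le_pos; lra| |easy].
    + apply Rmult_le_pos; [lra|]. apply Rmult_le_pos; [lra|easy].
    + apply Rmult_le_compat; try lra. apply Rmult_le_pos; lra.
Qed.

(** The inequality 2 |x| |y| <= x^2 + y^2 separates the product of distances. *)
Lemma inv_mult_le_wt x y : 1 <= Rabs x -> 1 <= Rabs y ->
  / (Rabs x * Rabs y) <= wt x + wt y.
Proof.
  intros Hx Hy. unfold wt. rewrite <- (pow2_abs x), <- (pow2_abs y).
  set (X := Rabs x) in *; set (Y := Rabs y) in *.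
  apply Rle_trans with (/ (2 * X ^ 2) + / (2 * Y ^ 2)).
  - apply Rmult_le_reg_r with (2 * X ^ 2 * Y ^ 2); [repeat apply Rmult_lt_0_compat; nra|].
    replace (/ (X * Y) * (2 * X ^ 2 * Y ^ 2)) with (2 * X * Y) by (field; lra).
    replace ((/ (2 * X ^ 2) + / (2 * Y ^ 2)) * (2 * X ^ 2 * Y ^ 2)) with (Y ^ 2 + X ^ 2) by (field; lra).
    pose proof (pow2_ge_0 (X - Y)). nra.
  - apply Rplus_le_compat; apply Rinv_le_contravar; nra.
Qed.

Lemma continuous_Re_cis A w t : continuous (fun t => Re (A * cis (w * t))%C) t.
Proof.
  apply (ex_derive_continuous (V := R_NormedModule)).
  unfold cis; simpl. auto_derive. easy.
Qed.

Lemma ex_RInt_Re_cis A w T : ex_RInt (fun t => Re (A * cis (w * t))%C) 0 T.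
Proof.
  apply (ex_RInt_continuous (V := R_CompleteNormedModule)).
  intros; apply continuous_Re_cis.
Qed.

Lemma abs_Re_mult_cis_le A x : Rabs (Re (A * cis x)%C) <= Cmod A.
Proof.
  eapply Rle_trans; [apply re_le_Cmod|]. rewrite Cmod_mult, Cmod_cis. lra.
Qed.

Lemma RInt_Re_cis_trivial A w T : 0 <= T ->
  Rabs (RInt (fun t => Re (A * cis (w * t))%C) 0 T) <= Cmod A * T.
Proof.
  intros HT. replace (Cmod A * T) with ((T - 0) * Cmod A) by ring.
  apply abs_RInt_le_const; [easy|apply ex_RInt_Re_cis|].
  intros; apply abs_Re_mult_cis_le.
Qed.

(** A primitive of A exp(i w t) is - i A exp(i w t) / w. *)
Lemma RInt_Re_cis_oscillating A w T : w <> 0 ->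
  Rabs (RInt (fun t => Re (A * cis (w * t))%C) 0 T) <= Cmod A * (2 / Rabs w).
Proof.
  intros Hw.
  set (F := fun t => Re (- Ci * A * cis (w * t))%C / w).
  assert (E : is_RInt (fun t => Re (A * cis (w * t))%C) 0 T (minus (F T) (F 0))).
  { apply (is_RInt_derive (V := R_CompleteNormedModule) F).
    - intros t _. unfold F, cis; simpl. auto_derive; [easy|]. field; easy.
    - intros; apply continuous_Re_cis. }
  rewrite (is_RInt_unique _ _ _ _ E).
  assert (HF : forall t, Rabs (F t) <= Cmod A / Rabs w).
  { intros t; unfold F, Rdiv. rewrite Rabs_mult, Rabs_inv.
    apply Rmult_le_compat_r; [left; apply Rinv_0_lt_compat, Rabs_pos_lt; easy|].
    eapply Rle_trans; [apply abs_Re_mult_cis_le|].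
    rewrite Cmod_mult, Cmod_opp, Cmod_Ci. lra. }
  change (Rabs (F T - F 0) <= Cmod A * (2 / Rabs w)).
  unfold Rminus. eapply Rle_trans; [apply Rabs_triang|]. rewrite Rabs_Ropp.
  pose proof (HF T); pose proof (HF 0). unfold Rdiv in *. lra.
Qed.

(** T accounts for the stationary terms, the inverse of cos(2 pi lam)^3 for the phase lower
    bound of [omega_gap]. *)
Definition gap_constant (T lam : R) : R := T + / cos (2 * PI * lam) ^ 3.

Lemma cos_low_freq_pos lam : 0 <= lam < 1 / 4 -> 0 < cos (2 * PI * lam).
Proof. intros H. pose proof PI_RGT_0. apply cos_gt_0; nra. Qed.

(** If k3 = k1 or k4 = k1 one of the weights is 1 and the trivial bound T suffices; otherwise
    the lower bound on the phase controls the oscillating integral. *)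
Lemma resonant_time_integral N T lam A k1 k2 k3 k4 :
  0 < T -> 0 <= lam < 1 / 4 -> (k1 + k2 = k3 + k4)%nat ->
  Rabs (IZR (freq N k1)) <= lam * INR N -> Rabs (IZR (freq N k2)) <= lam * INR N ->
  Rabs (IZR (freq N k3)) <= lam * INR N -> Rabs (IZR (freq N k4)) <= lam * INR N ->
  Rabs (RInt (fun t => Re (A * cis (- (omega N k1 + omega N k2 - omega N k3 - omega N k4) * t))%C) 0 T)
  <= gap_constant T lam * (Cmod A * (wt (INR k3 - INR k1) + wt (INR k4 - INR k1))).
Proof.
  intros HT Hlam Hk F1 F2 F3 F4.
  pose proof (omega_gap N lam k1 k2 k3 k4 Hlam Hk F1 F2 F3 F4) as Hg.
  pose proof (cos_low_freq_pos lam Hlam) as HK. unfold gap_constant.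
  set (K := cos (2 * PI * lam)) in *.
  set (W := omega N k1 + omega N k2 - omega N k3 - omega N k4) in *.
  pose proof (wt_pos (INR k3 - INR k1)) as Hw3; pose proof (wt_pos (INR k4 - INR k1)) as Hw4.
  pose proof (Cmod_ge_0 A) as HA.
  assert (HK3 : 0 < K ^ 3) by now apply pow_lt.
  assert (HK3i : 0 < / K ^ 3) by now apply Rinv_0_lt_compat.
  destruct (Nat.eq_dec k3 k1) as [E|N3]; [|destruct (Nat.eq_dec k4 k1) as [E|N4]].
  1,2: eapply Rle_trans; [apply RInt_Re_cis_trivial; lra|];
    assert (E' : wt (INR k1 - INR k1) = 1) by
      (unfold wt; replace (1 + _) with 1 by ring; apply Rinv_1);
    rewrite E in *; rewrite E';
    rewrite (Rmult_comm (Cmod A)), Rmult_comm with (r1 := Cmod A), <- Rmult_assoc;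
    apply Rmult_le_compat_r; [easy|nra].
  assert (D : forall k : nat, k <> k1 -> 1 <= Rabs (INR k - INR k1)).
  { intros k H. rewrite !INR_IZR_INZ, <- minus_IZR, <- abs_IZR. apply IZR_le. lia. }
  pose proof (D k3 N3) as D3; pose proof (D k4 N4) as D4.
  set (X := Rabs (INR k3 - INR k1)) in *; set (Y := Rabs (INR k4 - INR k1)) in *.
  assert (HXY : 0 < X * Y) by nra.
  assert (HKXY : 0 < 2 * K ^ 3 * (X * Y)) by nra.
  assert (HW : W <> 0) by (intros E; rewrite E, Rabs_R0 in Hg; lra).
  eapply Rle_trans; [apply RInt_Re_cis_oscillating; lra|].
  rewrite Rabs_Ropp.
  rewrite <- Rmult_assoc, (Rmult_comm _ (Cmod A)), Rmult_assoc.
  apply Rmult_le_compat_l; [easy|].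
  apply Rle_trans with (/ K ^ 3 * / (X * Y)).
  - replace (/ K ^ 3 * / (X * Y)) with (2 / (2 * K ^ 3 * (X * Y))) by (field; nra).
    apply Rmult_le_compat_l; [lra|]. now apply Rinv_le_contravar.
  - apply Rmult_le_compat; [lra|left; now apply Rinv_0_lt_compat|lra|].
    now apply inv_mult_le_wt.
Qed.

(** * Solutions of the semidiscrete equation *)

Lemma sum_n_Sn_first {G : AbelianMonoid} (f : nat -> G) n :
  sum_n f (S n) = plus (f 0%nat) (sum_n (fun k => f (S k)) n).
Proof.
  induction n as [|n IH]; [now rewrite sum_Sn, !sum_O|].
  now rewrite sum_Sn, IH, sum_Sn, plus_assoc.
Qed.

Definition next_index (N j : nat) : nat := if Nat.eqb j N then 0%nat else S j.
Definition prev_index (N j : nat) : nat := match j with O => N | S i => i end.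

Lemma next_eq N u j : next N u j = u (next_index N j).
Proof. unfold next, next_index; now destruct (Nat.eqb j N). Qed.

Lemma prev_eq N u j : prev N u j = u (prev_index N j).
Proof. now destruct j. Qed.

(** Summation by parts on the discrete torus. *)
Lemma sum_n_cyclic_shift {G : AbelianMonoid} N (f : nat -> nat -> G) :
  sum_n (fun j => f j (prev_index N j)) N = sum_n (fun j => f (next_index N j) j) N.
Proof.
  destruct N as [|N]; [now rewrite !sum_O|].
  rewrite sum_n_Sn_first, sum_Sn, plus_comm.
  unfold next_index at 2; rewrite Nat.eqb_refl. f_equal.
  apply sum_n_ext_loc; intros j Hj. unfold next_index.
  destruct (Nat.eqb_spec j (S N)); [lia|easy].
Qed.

Lemma Cdiv_RtoC z (r : R) : r <> 0 -> (z / r)%C = (Re z / r, Im z / r).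
Proof.
  intros Hr. unfold Cdiv, Cinv, Cmult, Re, Im, RtoC; simpl.
  f_equal; field; easy.
Qed.

Lemma Re_Ci_laplacian N u j : Re (Ci * discrete_laplacian N u j)%C =
  - (Im (u (next_index N j)) - 2 * Im (u j) + Im (u (prev_index N j))) / mesh N ^ 2.
Proof.
  unfold discrete_laplacian. pose proof (mesh_pos N).
  rewrite Cdiv_RtoC, next_eq, prev_eq by (apply pow_nonzero; lra).
  unfold Re, Im; simpl. field; lra.
Qed.

Lemma Im_Ci_laplacian N u j : Im (Ci * discrete_laplacian N u j)%C =
  (Re (u (next_index N j)) - 2 * Re (u j) + Re (u (prev_index N j))) / mesh N ^ 2.
Proof.
  unfold discrete_laplacian. pose proof (mesh_pos N).
  rewrite Cdiv_RtoC, next_eq, prev_eq by (apply pow_nonzero; lra).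
  unfold Re, Im; simpl. field; lra.
Qed.

(** The evolution equation u' = i Delta u in real form.  It separates the differential
    equation, which is stable under differences, from the initial condition. *)
Definition solves (N : nat) (u : R -> vec) : Prop :=
  forall j t, (j <= N)%nat -> 0 < t ->
    is_derive (fun s => Re (u s j)) t (Re (Ci * discrete_laplacian N (u t) j)%C) /\
    is_derive (fun s => Im (u s j)) t (Im (Ci * discrete_laplacian N (u t) j)%C).

Lemma is_derive_Re (f : R -> C) t d :
  @is_derive R_AbsRing C_R_NormedModule f t d -> is_derive (fun s => Re (f s)) t (Re d).
Proof.
  intros H.
  exact (filterdiff_comp' (K := R_AbsRing) (V := C_R_NormedModule) f fst t _ fst H
    (filterdiff_linear fst (is_linear_fst (K := R_AbsRing) (U := R_NormedModule) (V := R_NormedModule)))).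
Qed.

Lemma is_derive_Im (f : R -> C) t d :
  @is_derive R_AbsRing C_R_NormedModule f t d -> is_derive (fun s => Im (f s)) t (Im d).
Proof.
  intros H.
  exact (filterdiff_comp' (K := R_AbsRing) (V := C_R_NormedModule) f snd t _ snd H
    (filterdiff_linear snd (is_linear_snd (K := R_AbsRing) (U := R_NormedModule) (V := R_NormedModule)))).
Qed.

Lemma is_solution_solves N u0 u : is_solution N u0 u -> solves N u.
Proof.
  intros H j t Hj Ht. destruct (H j Hj) as (_ & _ & Hd).
  destruct (Hd t Ht) as (d & Hd1 & Hd2).
  replace (Ci * discrete_laplacian N (u t) j)%C with d.
  - split; [now apply is_derive_Re|now apply is_derive_Im].
  - transitivity (- Ci * (Ci * d))%C.
    + apply injective_projections; simpl; ring.
    + replace (Ci * d)%C with ((Ci * d + discrete_laplacian N (u t) j) - discrete_laplacian N (u t) j)%C by ring.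
      rewrite Hd2. ring.
Qed.

Lemma solves_minus N u v : solves N u -> solves N v ->
  solves N (fun t j => u t j - v t j)%C.
Proof.
  intros Hu Hv j t Hj Ht.
  destruct (Hu j t Hj Ht) as [Hu1 Hu2]; destruct (Hv j t Hj Ht) as [Hv1 Hv2].
  replace (Ci * discrete_laplacian N (fun j => u t j - v t j) j)%C with
    (Ci * discrete_laplacian N (u t) j - Ci * discrete_laplacian N (v t) j)%C.
  - split.
    + exact (is_derive_minus (V := R_NormedModule) _ _ t _ _ Hu1 Hv1).
    + exact (is_derive_minus (V := R_NormedModule) _ _ t _ _ Hu2 Hv2).
  - unfold discrete_laplacian, Cdiv. rewrite !next_eq, !prev_eq. ring.
Qed.

(** The derivative of the energy is 2 Re sum_j conj(w_j) i (Delta w)_j, which vanishes because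
    the discrete Laplacian is symmetric. *)
Lemma solves_conserves_energy N w t : solves N w -> 0 < t ->
  is_derive (fun s => sum_n (fun j => Re (w s j) ^ 2 + Im (w s j) ^ 2) N) t 0.
Proof.
  intros Hw Ht. pose proof (mesh_pos N) as Hh.
  (* The diagonal terms of the Laplacian cancel pointwise; the neighbours cancel after the
     cyclic shift. *)
  set (X := fun i j => Re (w t i) * Im (w t j)).
  assert (E : sum_n (fun j => 2 / mesh N ^ 2 *
     ((X (next_index N j) j + X (prev_index N j) j) + -1 * (X j (next_index N j) + X j (prev_index N j)))) N = 0).
  { rewrite <- sum_n_mult_l_R, !sum_n_plus_R, <- sum_n_mult_l_R, !sum_n_plus_R.
    rewrite <- (sum_n_cyclic_shift N X).
    rewrite (sum_n_cyclic_shift N (fun i j => X j i)). to_R; ring. }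
  rewrite <- E.
  apply (is_derive_sum_n (V := R_NormedModule) (fun j s => Re (w s j) ^ 2 + Im (w s j) ^ 2)).
  intros j Hj. destruct (Hw j t Hj Ht) as [H1 H2].
  rewrite Re_Ci_laplacian in H1; rewrite Im_Ci_laplacian in H2.
  evar_last.
  - apply (is_derive_plus (V := R_NormedModule)); apply is_derive_pow; [exact H1|exact H2].
  - change plus with Rplus. unfold X. simpl. to_R. field. lra.
Qed.

(** Uniqueness: the energy is constant for t > 0 and tends to 0 at 0. *)
Lemma solves_zero N w : solves N w ->
  (forall j, (j <= N)%nat -> filterlim (fun t => w t j) (at_right 0) (locally (RtoC 0))) ->
  forall j t, (j <= N)%nat -> 0 < t -> w t j = RtoC 0.
Proof.
  intros Hw H0 j t Hj Ht.
  set (E := fun s => sum_n (fun j => Re (w s j) ^ 2 + Im (w s j) ^ 2) N).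
  assert (Hc : forall s, 0 < s -> E s = E t).
  { assert (Hlt : forall a b, 0 < a -> a < b -> E a = E b).
    { intros a b Ha Hab. apply (eq_is_derive (V := R_NormedModule)); [|easy].
      intros s Hs. apply solves_conserves_energy; [easy|lra]. }
    intros s Hs. destruct (Rtotal_order s t) as [H|[H|H]]; [|now subst|symmetry]; now apply Hlt. }
  assert (Hlim : filterlim E (at_right 0) (locally 0)).
  { assert (Hj0 : forall j, (j <= N)%nat -> filterlim (fun s => Re (w s j) ^ 2 + Im (w s j) ^ 2)
        (at_right 0) (locally 0)).
    { intros i Hi. replace 0 with (Re 0 ^ 2 + Im 0 ^ 2) at 2 by (simpl; ring).
      apply (filterlim_comp _ _ _ (fun s => w s i) (fun z : C => Re z ^ 2 + Im z ^ 2) _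
        (locally (RtoC 0)) _); [now apply H0|].
      change (continuous (fun z : R * R => fst z ^ 2 + snd z ^ 2) (0, 0)).
      apply (continuous_plus (V := R_NormedModule)).
      - apply (continuous_comp (fun z : R * R => fst z) (fun x => x ^ 2)); [apply continuous_fst|].
        apply (ex_derive_continuous (V := R_NormedModule)); auto_derive; easy.
      - apply (continuous_comp (fun z : R * R => snd z) (fun x => x ^ 2)); [apply continuous_snd|].
        apply (ex_derive_continuous (V := R_NormedModule)); auto_derive; easy. }
    unfold E. clear - Hj0.
    replace (locally 0) with (locally (sum_n (fun _ => 0) N)) by now rewrite sum_n_0_R.
    induction N as [|N IH].
    - rewrite sum_O. apply filterlim_ext with (fun s => Re (w s 0%nat) ^ 2 + Im (w s 0%nat) ^ 2).
      + intros s; now rewrite sum_O.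
      + apply Hj0; lia.
    - rewrite sum_Sn.
      apply filterlim_ext with (fun s => plus (sum_n (fun j => Re (w s j) ^ 2 + Im (w s j) ^ 2) N)
         (Re (w s (S N)) ^ 2 + Im (w s (S N)) ^ 2)).
      + intros s; now rewrite sum_Sn.
      + eapply filterlim_comp_2; [apply IH; intros; apply Hj0; lia|apply Hj0; lia|].
        apply (filterlim_plus (V := R_NormedModule)). }
  assert (HE : E t = 0).
  { apply (filterlim_locally_unique (F := at_right 0) (V := R_NormedModule) (fun _ => E t)).
    - apply filterlim_const.
    - apply filterlim_ext_loc with E; [|exact Hlim].
      exists (mkposreal 1 Rlt_0_1); intros s _ Hs; now apply Hc. }
  assert (Hz : Re (w t j) ^ 2 + Im (w t j) ^ 2 = 0).
  { apply Rle_antisym; [|nra]. rewrite <- HE. unfold E. clear - Hj.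
    set (f := fun j => Re (w t j) ^ 2 + Im (w t j) ^ 2). change (f j <= sum_n f N).
    assert (Hf : forall k, 0 <= f k) by (intros k; unfold f; nra).
    clearbody f. induction N as [|N IH].
    - rewrite sum_O. replace j with 0%nat by lia. apply Rle_refl.
    - rewrite sum_Sn. change plus with Rplus.
      destruct (Nat.eq_dec j (S N)) as [->|Hn].
      + pose proof (sum_n_ge_0 f N (fun k _ => Hf k)). cbv beta in *. lra.
      + specialize (IH ltac:(lia)). pose proof (Hf (S N)). lra. }
  apply injective_projections; simpl; unfold Re, Im in *; nra.
Qed.

Lemma angle_period N k : cis (angle N k * INR (S N)) = RtoC 1.
Proof.
  rewrite <- (cis_2PI (freq N k)). f_equal. unfold angle.
  rewrite Rmult_assoc, mesh_mult. ring.
Qed.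

(** Characters are eigenvectors: since exp(i theta (N + 1)) = 1, the periodicity conventions
    turn the neighbours at both ends of the grid into plain shifts by one. *)
Lemma laplacian_trig N b j : (j <= N)%nat ->
  discrete_laplacian N (trig N b) j = trig N (fun k => - omega N k * b k)%C j.
Proof.
  intros Hj. pose proof (mesh_pos N) as Hh.
  assert (E1 : next N (trig N b) j = sum_n (fun k => b k * cis (angle N k * INR j) * cis (angle N k))%C N).
  { transitivity (trig N b (S j)).
    - unfold next. destruct (Nat.eqb_spec j N) as [->|]; [|easy].
      apply sum_n_ext; intros k. to_C. rewrite angle_period. simpl. now rewrite Rmult_0_r, cis_0.
    - apply sum_n_ext; intros k. to_C.
      rewrite S_INR, Rmult_plus_distr_l, Rmult_1_r, cis_plus. ring. }
  assert (E2 : prev N (trig N b) j = sum_n (fun k => b k * cis (angle N k * INR j) * cis (- angle N k))%C N).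
  { destruct j as [|j]; apply sum_n_ext; intros k; to_C.
    - simpl INR. rewrite Rmult_0_r, cis_0.
      replace (cis (- angle N k)) with (cis (- angle N k) * cis (angle N k * INR (S N)))%C
        by (rewrite angle_period; ring).
      rewrite <- cis_plus, S_INR.
      replace (- angle N k + angle N k * (INR N + 1)) with (angle N k * INR N) by ring. ring.
    - rewrite S_INR, Rmult_plus_distr_l, Rmult_1_r, cis_plus.
      transitivity (b k * cis (angle N k * INR j) * (cis (angle N k) * cis (- angle N k)))%C; [|ring].
      rewrite <- cis_plus, Rplus_opp_r, cis_0. ring. }
  unfold discrete_laplacian, Cdiv, Cminus. rewrite E1, E2.
  replace (- (2 * trig N b j))%C with ((- (2)) * trig N b j)%C by ring.
  unfold trig. rewrite sum_n_mult_l_C.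
  rewrite <- !(sum_n_plus (G := C_AbelianMonoid) : forall u v n, _ = Cplus (sum_n u n) (sum_n v n)).
  rewrite sum_n_mult_r_C. apply sum_n_ext; intros k. to_C. change plus with Cplus. cbv beta.
  transitivity (b k * cis (angle N k * INR j) * ((cis (angle N k) + cis (- angle N k) - 2) / (mesh N ^ 2)%R))%C.
  { unfold Cdiv. ring. }
  replace ((cis (angle N k) + cis (- angle N k) - 2) / (mesh N ^ 2)%R)%C with (- RtoC (omega N k))%C; [ring|].
  rewrite Cdiv_RtoC by (apply pow_nonzero; lra).
  unfold omega, cis; apply injective_projections; simpl; rewrite ?cos_neg, ?sin_neg; field; lra.
Qed.

(** The solution given by the dispersion relation. *)
Definition evolve (N : nat) (a : nat -> C) (t : R) : vec :=
  trig N (fun k => a k * cis (- omega N k * t))%C.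

Lemma Re_trig N b j : Re (trig N b j) = sum_n (fun k => Re (b k * cis (angle N k * INR j))%C) N.
Proof. apply Re_sum_n. Qed.

Lemma Im_trig N b j : Im (trig N b j) = sum_n (fun k => Im (b k * cis (angle N k * INR j))%C) N.
Proof. apply Im_sum_n. Qed.

Lemma evolve_solves N a : solves N (evolve N a).
Proof.
  intros j t Hj _. unfold evolve. rewrite laplacian_trig by easy.
  unfold trig at 2 4. rewrite sum_n_mult_l_C, Re_sum_n, Im_sum_n.
  split; eapply is_derive_ext; try (intros; symmetry; (apply Re_trig || apply Im_trig)).
  - apply (is_derive_sum_n (V := R_NormedModule) (fun k s => Re (a k * cis (- omega N k * s) * cis (angle N k * INR j))%C)).
    intros k _. unfold cis, Re, Im; simpl. auto_derive; [easy|]. ring.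
  - apply (is_derive_sum_n (V := R_NormedModule) (fun k s => Im (a k * cis (- omega N k * s) * cis (angle N k * INR j))%C)).
    intros k _. unfold cis, Re, Im; simpl. auto_derive; [easy|]. ring.
Qed.

Lemma evolve_0 N a j : evolve N a 0 j = trig N a j.
Proof.
  apply sum_n_ext; intros k. to_C. rewrite Rmult_0_r, cis_0. ring.
Qed.

(** The limit at time 0 of a solution is taken in the product uniform structure of C, which
    the type annotation selects. *)
Lemma continuous_C_pair (f : R -> C) t :
  continuous (fun s => Re (f s)) t -> continuous (fun s => Im (f s)) t ->
  continuous (f : R -> R * R) t.
Proof.
  intros H1 H2. apply continuous_ext with (fun s => (Re (f s), Im (f s))).
  - intros s; now destruct (f s).
  - unfold continuous.
    apply (filterlim_filter_le_2 (G := filter_prod (locally (Re (f t))) (locally (Im (f t))))).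
    + rewrite (surjective_pairing (f t)). intros P [e He].
      apply Filter_prod with (ball (Re (f t)) e) (ball (Im (f t)) e); try apply locally_ball.
      intros x y Hx Hy; apply He; now split.
    + now apply filterlim_pair.
Qed.

Lemma continuous_evolve N a j t : continuous (fun s => evolve N a s j : R * R) t.
Proof.
  apply continuous_C_pair.
  - eapply continuous_ext; [intros; symmetry; apply Re_trig|].
    apply (ex_derive_continuous (V := R_NormedModule)).
    eexists. apply (is_derive_sum_n (V := R_NormedModule) (fun k s => Re (a k * cis (- omega N k * s) * cis (angle N k * INR j))%C)).
    intros k _. unfold cis, Re; simpl. apply Derive_correct. auto_derive; easy.
  - eapply continuous_ext; [intros; symmetry; apply Im_trig|].
    apply (ex_derive_continuous (V := R_NormedModule)).
    eexists. apply (is_derive_sum_n (V := R_NormedModule) (fun k s => Im (a k * cis (- omega N k * s) * cis (angle N k * INR j))%C)).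
    intros k _. unfold cis, Im; simpl. apply Derive_correct. auto_derive; easy.
Qed.

(** The difference of the two functions solves the equation and tends to 0 at time 0. *)
Lemma is_solution_unique N a u0 u :
  (forall j, (j <= N)%nat -> u0 j = trig N a j) -> is_solution N u0 u ->
  forall j t, (j <= N)%nat -> 0 < t -> u t j = evolve N a t j.
Proof.
  intros H0 Hu j t Hj Ht.
  enough (E : (u t j - evolve N a t j)%C = RtoC 0).
  { transitivity ((u t j - evolve N a t j) + evolve N a t j)%C; [ring|rewrite E; ring]. }
  apply (solves_zero N (fun t j => u t j - evolve N a t j)%C); trivial.
  - apply solves_minus; [now apply is_solution_solves with u0|apply evolve_solves].
  - intros i Hi. destruct (Hu i Hi) as (_ & Hl & _).
    replace (RtoC 0) with (plus (u0 i) (opp (evolve N a 0 i))).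
    2:{ rewrite evolve_0, H0 by easy. apply (plus_opp_r (G := C_AbelianGroup)). }
    eapply (filterlim_comp_2 (fun t => u t i) (fun t => opp (evolve N a t i)) plus).
    + exact Hl.
    + eapply filterlim_comp; [|apply (filterlim_opp (V := C_R_NormedModule))].
      eapply filterlim_filter_le_1; [|apply continuous_evolve]. apply filter_le_within.
    + apply (filterlim_plus (V := C_R_NormedModule)).
Qed.

(** * The space-time estimate *)

Lemma rpow_pow x n : (0 < n)%nat -> 0 <= x -> rpow x (INR n) = x ^ n.
Proof.
  intros Hn Hx. unfold rpow. destruct (Req_dec_T x 0) as [->|H].
  - now rewrite pow_i.
  - apply Rpower_pow; lra.
Qed.

Lemma rpow_ge_0 x p : 0 <= rpow x p.
Proof.
  unfold rpow; destruct Req_dec_T; [lra|]. left; apply exp_pos.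
Qed.

Lemma rpow_inv_pow x n : (0 < n)%nat -> 0 <= x -> rpow x (/ INR n) ^ n = x.
Proof.
  intros Hn Hx. unfold rpow. destruct (Req_dec_T x 0) as [->|H].
  - now rewrite pow_i.
  - rewrite <- Rpower_pow by apply exp_pos.
    rewrite Rpower_mult, Rinv_l, Rpower_1; [easy|lra|]. apply not_0_INR; lia.
Qed.

Lemma rpow_inv_le x y n : (0 < n)%nat -> 0 <= x -> 0 <= y -> x <= y ^ n ->
  rpow x (/ INR n) <= y.
Proof.
  intros Hn Hx Hy H. unfold rpow. destruct (Req_dec_T x 0) as [_|Hx0]; [easy|].
  assert (HnR : 0 < INR n) by now apply lt_0_INR.
  assert (Hy0 : 0 < y).
  { destruct Hy as [|<-]; [easy|]. rewrite pow_i in H by easy. lra. }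
  rewrite <- (Rpower_1 y) at 1 by easy.
  rewrite <- (Rinv_r (INR n)), <- Rpower_mult, Rpower_pow by lra.
  apply Rle_Rpower_l; [left; now apply Rinv_0_lt_compat|lra].
Qed.

Lemma Lp_norm_pow N n u : (0 < n)%nat ->
  Lp_norm N (INR n) u ^ n = mesh N * sum_n (fun j => Cmod (u j) ^ n) N.
Proof.
  intros Hn. unfold Lp_norm.
  rewrite (sum_n_ext _ (fun j => Cmod (u j) ^ n)).
  2:{ intros j; apply rpow_pow; [easy|apply Cmod_ge_0]. }
  apply rpow_inv_pow; [easy|].
  apply Rmult_le_pos; [left; apply mesh_pos|].
  apply sum_n_ge_0; intros; apply pow_le, Cmod_ge_0.
Qed.

(** The estimate with both norms raised to the fourth power: the fourth moment is integrated
    term by term over the resonant quadruples. *)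
Lemma evolve_fourth_moment_integral N T lam a :
  (0 < N)%nat -> 0 < T -> 0 <= lam < 1 / 4 -> low_freq N lam a ->
  exists I,
    is_RInt (fun t => mesh N * sum_n (fun j => Cmod (evolve N a t j) ^ 4) N) 0 T I /\
    I <= 12 * gap_constant T lam * (sum_n (fun k => Cmod (a k) ^ 2) N) ^ 2.
Proof.
  intros HN HT Hlam Ha.
  set (A := fun k1 k2 k3 k4 => (a k1 * a k2 * Cconj (a k3) * Cconj (a k4))%C).
  set (W := fun k1 k2 k3 k4 => omega N k1 + omega N k2 - omega N k3 - omega N k4).
  set (f := fun k1 k2 k3 k4 t => if Nat.eqb (k1 + k2) (k3 + k4)
     then Re (A k1 k2 k3 k4 * cis (- W k1 k2 k3 k4 * t))%C else 0).
  exists (sum4 N (fun k1 k2 k3 k4 => RInt (f k1 k2 k3 k4) 0 T)). split.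
  - apply is_RInt_ext with (fun t => sum4 N (fun k1 k2 k3 k4 => f k1 k2 k3 k4 t)).
    { intros t _. unfold evolve. symmetry.
      rewrite (trig_fourth_moment N lam _ HN (proj2 Hlam)).
      2:{ intros k Hk. destruct (Ha k Hk) as [->|?]; [left; ring|now right]. }
      apply sum4_ext; intros k1 k2 k3 k4 _ _ _ _. unfold f.
      destruct (Nat.eqb _ _); [|easy]. to_R. f_equal. unfold A, W.
      replace (- (omega N k1 + omega N k2 - omega N k3 - omega N k4) * t) with
        (- omega N k1 * t + - omega N k2 * t + - (- omega N k3 * t) + - (- omega N k4 * t)) by ring.
      rewrite !Cmult_conj, !cis_conj, !cis_plus. ring. }
    apply is_RInt_sum4; intros k1 k2 k3 k4. apply (RInt_correct (V := R_CompleteNormedModule)).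
    unfold f. destruct (Nat.eqb _ _); [apply ex_RInt_Re_cis|apply ex_RInt_const].
  - apply Rle_trans with (gap_constant T lam * sum4 N (fun k1 k2 k3 k4 =>
      if Nat.eqb (k1 + k2) (k3 + k4) then Cmod (a k1) * Cmod (a k2) * Cmod (a k3) * Cmod (a k4) *
        (wt (INR k3 - INR k1) + wt (INR k4 - INR k1)) else 0)).
    2:{ pose proof (cos_low_freq_pos lam Hlam) as HK.
        apply Rle_trans with (gap_constant T lam * (12 * sum_n (fun k => Cmod (a k) ^ 2) N ^ 2)); [|right; ring].
        apply Rmult_le_compat_l; [|apply (resonant_sum_le (fun k => Cmod (a k)))].
        unfold gap_constant. pose proof (Rinv_0_lt_compat _ (pow_lt _ 3 HK)). lra. }
    rewrite sum4_mult_l_R. apply sum4_le; intros k1 k2 k3 k4 H1 H2 H3 H4. unfold f.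
    destruct (Nat.eqb_spec (k1 + k2) (k3 + k4)) as [Hk|_].
    2:{ rewrite RInt_const. change (scal (T - 0) 0) with ((T - 0) * 0). right; ring. }
    eapply Rle_trans; [apply Rle_abs|].
    replace (Cmod (a k1) * Cmod (a k2) * Cmod (a k3) * Cmod (a k4)) with (Cmod (A k1 k2 k3 k4))
      by (unfold A; now rewrite !Cmod_mult, !Cmod_conj).
    destruct (low_freq_product N lam a k1 k2 k3 k4 Ha H1 H2 H3 H4) as [E|(F1 & F2 & F3 & F4)].
    + eapply Rle_trans; [apply RInt_Re_cis_trivial; lra|].
      unfold A; rewrite E, Cmod_0. right; ring.
    + now apply resonant_time_integral.
Qed.

(** Replacing lam by its positive part keeps the datum low-frequency and provides the bound
    0 <= lam under which cos(2 pi lam) is the minimum of the cosine on the relevant angles. *)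
Lemma in_low_freq_span_trig N lam u0 : in_low_freq_span N lam u0 ->
  exists a, low_freq N (Rmax lam 0) a /\ forall j, (j <= N)%nat -> u0 j = trig N a j.
Proof.
  intros (a & Ha & Hu). exists (fun k => a (freq N k)). split.
  - intros k Hk.
    destruct (Rle_dec (Rabs (IZR (freq N k))) (lam * INR N)) as [H|H].
    + right. eapply Rle_trans; [exact H|].
      apply Rmult_le_compat_r; [apply pos_INR|apply Rmax_l].
    + left; now apply Ha.
  - intros j Hj. rewrite Hu by easy. apply sum_n_ext; intros k. now rewrite <- phi_cis.
Qed.

Theorem theorem3p1 :
  forall T lam : R, 0 < T -> lam < 1 / 4 ->
  exists c : R, 0 < c /\
    forall N : nat, Nat.Even N -> (0 < N)%nat ->
    forall u0 : vec, in_low_freq_span N lam u0 ->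
    forall u : R -> vec, is_solution N u0 u ->
      LqLp_norm N 4 4 T u <= c * Lp_norm N 2 u0.
Proof.
  intros T lam HT Hlam.
  assert (Hlam' : 0 <= Rmax lam 0 < 1 / 4).
  { split; [apply Rmax_r|apply Rmax_lub_lt; lra]. }
  set (D := 12 * gap_constant T (Rmax lam 0)).
  assert (HD : 0 < D).
  { unfold D, gap_constant. pose proof (cos_low_freq_pos _ Hlam') as HK.
    pose proof (Rinv_0_lt_compat _ (pow_lt _ 3 HK)). lra. }
  (* 1 + D is at least 1, hence at most its fourth power, which spares a fourth root. *)
  exists (1 + D). split; [lra|].
  intros N _ HN u0 Hu0 u Hu.
  destruct (in_low_freq_span_trig N lam u0 Hu0) as (a & Ha & Hu0a).
  destruct (evolve_fourth_moment_integral N T (Rmax lam 0) a HN HT Hlam' Ha) as (I & HI & HIle).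
  fold D in HIle.
  assert (E4 : 4 = INR 4) by (simpl; ring). assert (E2 : 2 = INR 2) by (simpl; ring).
  assert (HQ : sum_n (fun k => Cmod (a k) ^ 2) N = Lp_norm N 2 u0 ^ 2).
  { rewrite E2, Lp_norm_pow, <- trig_second_moment by lia. f_equal.
    apply sum_n_ext_loc; intros j Hj. now rewrite Hu0a. }
  rewrite HQ in HIle.
  assert (HL : 0 <= Lp_norm N 2 u0) by apply rpow_ge_0.
  unfold LqLp_norm.
  replace (RInt _ 0 T) with I.
  2:{ symmetry. apply is_RInt_unique. eapply is_RInt_ext; [|exact HI].
      rewrite Rmin_left, Rmax_right by lra. intros t Ht. cbv beta.
      rewrite E4, rpow_pow by (try lia; apply rpow_ge_0).
      rewrite Lp_norm_pow by lia. f_equal. apply sum_n_ext_loc; intros j Hj.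
      now rewrite (is_solution_unique N a u0 u Hu0a Hu j t Hj) by lra. }
  rewrite E4. apply rpow_inv_le; [lia| |apply Rmult_le_pos; lra|].
  - apply (is_RInt_ge_0 _ 0 T I ltac:(lra) HI). intros t _.
    apply Rmult_le_pos; [left; apply mesh_pos|].
    apply sum_n_ge_0; intros; apply pow_le, Cmod_ge_0.
  - eapply Rle_trans; [exact HIle|].
    rewrite Rpow_mult_distr, <- pow_mult. apply Rmult_le_compat_r; [apply pow_le; easy|].
    apply Rle_trans with (1 + D); [lra|].
    rewrite <- (pow_1 (1 + D)) at 1. apply Rle_pow; [lra|lia].
Qed.
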